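(* Let $a,n$ be positive integers with $0<a<n$ and $\gcd(a,n)=1$, and let $p$ be the period of the function $f(x)=a^x \bmod n$. Then $p<n$.
   Context: For $0<a<n$, the modular exponentiation function is $f:\mathbb{N}_0\to\mathbb{N}_0$, $f(x)=a^x \bmod n$, where $z \bmod n = z-\lfloor z/n\rfloor n$ is the remainder of $z$ on division by $n$. The period of $f$ is the smallest positive integer $p$ such that $f(x)=f(x+p)$ for all $x\in\mathbb{N}_0$. *)

(* Defs.v *)
From mathcomp Require Import all_boot.
Set Implicit Arguments.
Unset Strict Implicit.
Unset Printing Implicit Defensive.

Definition modexp (a n x : nat) : nat := a ^ x %% n.

Definition periodic (f : nat -> nat) (p : nat) : Prop :=
  forall x, f x = f (x + p).

(* A relation rather than a function, since an arbitrary [f] need not have a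
   period; minimality makes [p] unique when it exists. *)
Definition is_period (f : nat -> nat) (p : nat) : Prop :=
  [/\ 0 < p, periodic f p
    & forall q, 0 < q -> periodic f q -> p <= q].

(* Main.v *)
Require Import Defs.
From mathcomp Require Import all_boot.
From mathcomp Require Import cyclic.

(** By Euler's theorem [a ^ totient n] is congruent to 1 modulo [n], so
    [totient n] is a positive period of [modexp a n] and bounds the least one.
    As [1 < n], the residue 0 is not coprime to [n], hence [totient n < n]. *)

Lemma totient_ltn n : 1 < n -> totient n < n.
Proof.
move=> n_gt1; rewrite totient_count_coprime big_ltn ?(ltnW n_gt1) //.
rewrite /coprime gcdn0 (gtn_eqF n_gt1) add0n.
apply: (@leq_ltn_trans (\sum_(1 <= d < n) 1)).
  by apply: leq_sum => d _; exact: leq_b1.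
by rewrite sum_nat_const_nat muln1 subn1 ltn_predL ltnW.
Qed.

Lemma modexp_periodic_totient a n :
  coprime a n -> periodic (modexp a n) (totient n).
Proof.
move=> co_an x; rewrite /modexp expnD -modnMmr.
by rewrite Euler_exp_totient // modnMmr muln1.
Qed.

Theorem lemma41 (a n p : nat) (a_gt0 : 0 < a) (a_lt_n : a < n)
  (gcd_an : gcdn a n = 1) (p_period : is_period (modexp a n) p) :
  p < n.
Proof.
have n_gt1 : 1 < n by exact: leq_ltn_trans a_gt0 a_lt_n.
case: p_period => _ _ p_min.
apply: leq_ltn_trans (totient_ltn _ n_gt1); apply: p_min.
  by rewrite totient_gt0 ltnW.
by apply: modexp_periodic_totient; rewrite /coprime gcd_an.
Qed.
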